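(* Let $0< v_i^l\le v_i^u$, $0< v_j^l\le v_j^u$ and $-\pi/2<\theta_{ij}^l<\theta_{ij}^u<\pi/2$ be real constants, and put $$\phi_{ij}=\tfrac{\theta_{ij}^u+\theta_{ij}^l}{2},\quad \delta_{ij}=\tfrac{\theta_{ij}^u-\theta_{ij}^l}{2},\quad v_i^\sigma=v_i^l+v_i^u,\quad v_j^\sigma=v_j^l+v_j^u,$$ $$c_{11}=v_i^\sigma v_j^\sigma\cos\phi_{ij},\quad c_{12}=v_i^\sigma v_j^\sigma\sin\phi_{ij},\quad c_{13}=-v_j^u\cos(\delta_{ij})v_j^\sigma,\quad c_{14}=-v_i^u\cos(\delta_{ij})v_i^\sigma,$$ $$c_{15}=-v_i^uv_j^u\cos(\delta_{ij})\,(v_i^lv_j^l-v_i^uv_j^u).$$ Then every $(w^R_{ij},w^I_{ij},w_i)\in\mathcal S_p$ (with $\mathcal S_p\subset\mathbb{R}^3$ defined in the context) satisfies $$c_{11}w^R_{ij}+c_{12}w^I_{ij}+c_{13}w_i+c_{14}\frac{(w^R_{ij})^2+(w^I_{ij})^2}{w_i}+c_{15}\ge 0 .$$ That is, this nonlinear cut is redundant with respect to $\mathcal S_p$.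
   Context: $\mathcal S_p$ is the set of all $(w^R_{ij},w^I_{ij},w_i)\in\mathbb{R}^3$ such that (1) $(v_i^l)^2\le w_i\le (v_i^u)^2$; (2) $w^{Rl}_{ij}\le w^R_{ij}\le w^{Ru}_{ij}$; (3) $w^{Il}_{ij}\le w^I_{ij}\le w^{Iu}_{ij}$; (4) $\tan(\theta^l_{ij})w^R_{ij}\le w^I_{ij}\le\tan(\theta^u_{ij})w^R_{ij}$; (5) $w_i(v_j^l)^2\le (w^R_{ij})^2+(w^I_{ij})^2\le w_i(v_j^u)^2$. The bounds in (2),(3) are the following constants. If $\theta^l_{ij},\theta^u_{ij}\le 0$: $w^{Rl}_{ij}=v^l_iv^l_j\cos\theta^l_{ij}$, $w^{Ru}_{ij}=v^u_iv^u_j\cos\theta^u_{ij}$, $w^{Il}_{ij}=v^u_iv^u_j\sin\theta^l_{ij}$, $w^{Iu}_{ij}=v^l_iv^l_j\sin\theta^u_{ij}$. If $\theta^l_{ij},\theta^u_{ij}\ge 0$: $w^{Rl}_{ij}=v^l_iv^l_j\cos\theta^u_{ij}$, $w^{Ru}_{ij}=v^u_iv^u_j\cos\theta^l_{ij}$, $w^{Il}_{ij}=v^l_iv^l_j\sin\theta^l_{ij}$, $w^{Iu}_{ij}=v^u_iv^u_j\sin\theta^u_{ij}$. If $\theta^l_{ij}<0<\theta^u_{ij}$: $w^{Rl}_{ij}=v^l_iv^l_j\min(\cos\theta^l_{ij},\cos\theta^u_{ij})$, $w^{Ru}_{ij}=v^u_iv^u_j$, $w^{Il}_{ij}=v^u_iv^u_j\sin\theta^l_{ij}$,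 $w^{Iu}_{ij}=v^u_iv^u_j\sin\theta^u_{ij}$. A constraint is redundant with respect to a set if every point of the set satisfies it. *)

(* Defs.v *)
From mathcomp Require Import all_boot all_order all_algebra.
From mathcomp Require Import all_classical all_reals all_analysis.

Set Implicit Arguments.
Unset Strict Implicit.
Unset Printing Implicit Defensive.

Import Order.TTheory GRing.Theory Num.Theory.
Import numFieldNormedType.Exports.

Local Open Scope classical_set_scope.
Local Open Scope ring_scope.

(* [vil, viu] and [vjl, vju] are the voltage magnitude ranges at the two ends
   i, j of the line, [tl, tu] the range of the phase angle difference.  For
   tl < tu the first two tests below exclude each other, and the last branch
   is the case tl < 0 < tu. *)

Definition wRl (R : realType) (vil vjl tl tu : R) : R :=
  if (tl <= 0) && (tu <= 0) then vil * vjl * cos tl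
  else if (0 <= tl) && (0 <= tu) then vil * vjl * cos tu
  else vil * vjl * Num.min (cos tl) (cos tu).

Definition wRu (R : realType) (viu vju tl tu : R) : R :=
  if (tl <= 0) && (tu <= 0) then viu * vju * cos tu
  else if (0 <= tl) && (0 <= tu) then viu * vju * cos tl
  else viu * vju.

Definition wIl (R : realType) (vil viu vjl vju tl tu : R) : R :=
  if (tl <= 0) && (tu <= 0) then viu * vju * sin tl
  else if (0 <= tl) && (0 <= tu) then vil * vjl * sin tl
  else viu * vju * sin tl.

Definition wIu (R : realType) (vil viu vjl vju tl tu : R) : R :=
  if (tl <= 0) && (tu <= 0) then vil * vjl * sin tu
  else if (0 <= tl) && (0 <= tu) then viu * vju * sin tu
  else viu * vju * sin tu.

Definition Sp (R : realType) (vil viu vjl vju tl tu : R) : set (R * R * R) :=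
  [set w | let: (wR, wI, wi) := w in
    [/\ vil ^+ 2 <= wi <= viu ^+ 2,
        wRl vil vjl tl tu <= wR <= wRu viu vju tl tu,
        wIl vil viu vjl vju tl tu <= wI <= wIu vil viu vjl vju tl tu,
        tan tl * wR <= wI <= tan tu * wR &
        wi * vjl ^+ 2 <= wR ^+ 2 + wI ^+ 2 <= wi * vju ^+ 2]].

Definition redundant (T : Type) (C S : set T) : Prop := forall w, S w -> C w.

(* Main.v *)
Require Import Defs.
From mathcomp Require Import all_boot all_order all_algebra.
From mathcomp Require Import all_classical all_reals all_analysis.
From mathcomp Require Import ring lra.

Import Order.TTheory GRing.Theory Num.Theory.
Import numFieldNormedType.Exports.

Local Open Scope classical_set_scope.
Local Open Scope ring_scope.

(** Put [x = sqrt wi] and [y = sqrt ((wR^2 + wI^2) / wi)], so that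
    [vil <= x <= viu] and [vjl <= y <= vju].  The angle constraints place
    [(wR, wI)] in the sector of half-angle [delta] around the direction [phi],
    hence [cos phi wR + sin phi wI >= x y cos delta].  After division by
    [cos delta] there remains a quadratic form in [(x, y)] that is concave in
    each variable, so its minimum over the rectangle is attained at a vertex;
    it vanishes at three vertices and equals
    [(viu^2 - vil^2) (vju^2 - vjl^2)] at the fourth. *)

Lemma sqrtr_itv {R : rcfType} {l u z : R} : 0 <= l -> 0 <= u ->
  l ^+ 2 <= z -> z <= u ^+ 2 -> l <= Num.sqrt z <= u.
Proof.
move=> l0 u0 lz zu; rewrite -(ger0_norm l0) -(ger0_norm u0) -!sqrtr_sqr.
by rewrite !ler_wsqrtr.
Qed.

(** Multiplying by [cos t] clears the tangent; the result is linear in [sin t] and [cos t], ready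
    for the addition formulas. *)
Lemma tan_cone_bounds {R : realType} {t : R} (u v : R) : 0 < cos t ->
  ((tan t * u <= v) = (sin t * u <= cos t * v)) *
  ((v <= tan t * u) = (cos t * v <= sin t * u)).
Proof.
move=> ct; have E : cos t * (tan t * u) = sin t * u.
  by rewrite /tan; field; rewrite gt_eqF.
by rewrite -E !ler_pM2l.
Qed.

(** Rotating by [- phi] turns [(u, v)] into [(L, M)], and the two sector inequalities say that
    [cos delta * M] lies between [- sin delta * L] and [sin delta * L]. *)
Lemma cone_projection_ge {R : realType} {phi delta u v r : R} :
    0 < sin delta -> 0 <= r -> r ^+ 2 = u ^+ 2 + v ^+ 2 ->
    sin (phi - delta) * u <= cos (phi - delta) * v ->
    cos (phi + delta) * v <= sin (phi + delta) * u ->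
  r * cos delta <= cos phi * u + sin phi * v.
Proof.
move=> sd r0 rE; rewrite sinB cosB sinD cosD => lo up.
set L := cos phi * u + sin phi * v.
pose M := cos phi * v - sin phi * u.
have lo' : 0 <= sin delta * L + cos delta * M by rewrite /L /M; lra.
have up' : 0 <= sin delta * L - cos delta * M by rewrite /L /M; lra.
have L0 : 0 <= L by rewrite -(pmulr_rge0 _ sd); lra.
have LM : r ^+ 2 = L ^+ 2 + M ^+ 2.
  transitivity ((cos phi ^+ 2 + sin phi ^+ 2) * (u ^+ 2 + v ^+ 2)).
    by rewrite cos2Dsin2 mul1r.
  by rewrite /L /M; ring.
(* The product is [sin^2 L^2 - cos^2 M^2] at [delta]; adding [cos^2 L^2] to both terms gives
   [L^2 >= cos^2 (L^2 + M^2)]. *)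
have sector := mulr_ge0 lo' up'.
have key : (r * cos delta) ^+ 2 <= L ^+ 2.
  have -> : L ^+ 2 = (cos delta ^+ 2 + sin delta ^+ 2) * L ^+ 2.
    by rewrite cos2Dsin2 mul1r.
  rewrite exprMn LM; lra.
apply: le_trans (ler_norm _) _.
by rewrite -ler_sqr ?nnegrE// real_normK ?num_real.
Qed.

Lemma rectangle_form_ge0 {R : realFieldType} {a A b B x y : R} :
    0 <= a -> 0 <= b -> a <= x <= A -> b <= y <= B ->
  0 <= (a + A) * (b + B) * (x * y) - B * (b + B) * x ^+ 2
       - A * (a + A) * y ^+ 2 - A * B * (a * b - A * B).
Proof.
move=> a0 b0 /andP[ax xA] /andP[yb yB].
(* The first two terms are the concave parts, zero at the endpoints; the third is the bilinear
   interpolant of the vertex values, nonzero at most at [(a, b)]. *)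
have -> : (a + A) * (b + B) * (x * y) - B * (b + B) * x ^+ 2
       - A * (a + A) * y ^+ 2 - A * B * (a * b - A * B) =
  B * (b + B) * ((x - a) * (A - x)) + A * (a + A) * ((y - b) * (B - y))
  + (a + A) * (b + B) * ((A - x) * (B - y)) by ring.
by rewrite !addr_ge0 // !mulr_ge0 //; lra.
Qed.

Theorem theorem4p3 (R : realType) (vil viu vjl vju tl tu : R)
  (hvil : 0 < vil) (hvi : vil <= viu) (hvjl : 0 < vjl) (hvj : vjl <= vju)
  (htl : - (pi / 2) < tl) (htlu : tl < tu) (htu : tu < pi / 2) :
  let phi := (tu + tl) / 2 in
  let delta := (tu - tl) / 2 in
  let vis := vil + viu in
  let vjs := vjl + vju in
  let c11 := vis * vjs * cos phi in
  let c12 := vis * vjs * sin phi in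
  let c13 := - (vju * cos delta * vjs) in
  let c14 := - (viu * cos delta * vis) in
  let c15 := - (viu * vju * cos delta * (vil * vjl - viu * vju)) in
  redundant
    [set w : R * R * R | let: (wR, wI, wi) := w in
      0 <= c11 * wR + c12 * wI + c13 * wi
           + c14 * ((wR ^+ 2 + wI ^+ 2) / wi) + c15]
    (Sp vil viu vjl vju tl tu).
Proof.
move=> phi delta vis vjs c11 c12 c13 c14 c15 [[wR wI] wi] /=.
case=> /andP[wil wiu] _ _ /andP[lo up] /andP[vl vu].
have tlE : tl = phi - delta by rewrite /phi /delta; lra.
have tuE : tu = phi + delta by rewrite /phi /delta; lra.
have ctl : 0 < cos tl by apply: cos_gt0_pihalf; rewrite htl; lra.
have ctu : 0 < cos tu by apply: cos_gt0_pihalf; rewrite htu andbT; lra.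
have cd : 0 < cos delta.
  by apply: cos_gt0_pihalf; apply/andP; split; rewrite /delta; lra.
have sd : 0 < sin delta.
  by apply: sin_gt0_pi; apply/andP; split; rewrite /delta; have := pi_gt0 R; lra.
have wi0 : 0 < wi by apply: lt_le_trans wil; rewrite exprn_gt0.
pose s := (wR ^+ 2 + wI ^+ 2) / wi.
have sl : vjl ^+ 2 <= s by rewrite ler_pdivlMr// mulrC.
have su : s <= vju ^+ 2 by rewrite ler_pdivrMr// mulrC.
have s0 : 0 <= s by apply: le_trans sl; rewrite sqr_ge0.
have viu0 := lt_le_trans hvil hvi; have vju0 := lt_le_trans hvjl hvj.
have xb := sqrtr_itv (ltW hvil) (ltW viu0) wil wiu.
have yb := sqrtr_itv (ltW hvjl) (ltW vju0) sl su.
have := rectangle_form_ge0 (ltW hvil) (ltW hvjl) xb yb.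
rewrite !sqr_sqrtr ?(ltW wi0)//.
set r := _ * Num.sqrt s => Q.
have r0 : 0 <= r by rewrite mulr_ge0 ?sqrtr_ge0.
have rE : r ^+ 2 = wR ^+ 2 + wI ^+ 2.
  by rewrite exprMn !sqr_sqrtr ?(ltW wi0)// mulrC divfK ?gt_eqF.
rewrite (tan_cone_bounds _ _ ctl) tlE in lo.
rewrite (tan_cone_bounds _ _ ctu) tuE in up.
have proj := cone_projection_ge sd r0 rE lo up.
have vv0 : 0 <= vis * vjs by rewrite mulr_ge0 // /vis /vjs; lra.
(* The cut is exactly [cos delta] times the rectangle form plus [vis * vjs] times the slack of
   [proj]: the terms in [r] cancel. *)
have := addr_ge0 (mulr_ge0 (ltW cd) Q)
  (mulr_ge0 vv0 (_ : 0 <= cos phi * wR + sin phi * wI - r * cos delta)).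
rewrite subr_ge0 => /(_ proj) /le_trans; apply.
by rewrite le_eqVlt; apply/orP; left; apply/eqP;
  rewrite -/s /c11 /c12 /c13 /c14 /c15 /vis /vjs; ring.
Qed.
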